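(* For any $0<p<1$ and any $\alpha\in[1,2]$, for $m_p\times\lambda$-almost every $(\omega,x)\in\Omega^{\mathbb N}\times[-1,1]$ the frequency of the digit $0$ in the random signed binary expansion of $(\omega,x)$, $$\pi_0(\alpha,p)=\lim_{n\to\infty}\frac1n\,\#\{1\le k\le n:\ s_k(\omega,x)=0\},$$ is at most $\frac12$.
   Context: Let $\Omega=\{0,1\}$, $\alpha\in[1,2]$. Define $T_{\alpha,0},T_{\alpha,1}:[-1,1]\to[-1,1]$ by $T_{\alpha,0}(x)=2x+\alpha$ if $x\in[-1,\frac{1-\alpha}2]$, $2x$ if $x\in(\frac{1-\alpha}2,\frac12]$, $2x-\alpha$ if $x\in(\frac12,1]$; $T_{\alpha,1}(x)=2x+\alpha$ if $x\in[-1,-\frac12)$, $2x$ if $x\in[-\frac12,\frac{\alpha-1}2)$, $2x-\alpha$ if $x\in[\frac{\alpha-1}2,1]$. The random symmetric doubling map is $R_\alpha(\omega,x)=(\sigma(\omega),T_{\alpha,\omega_1}(x))$ on $\Omega^{\mathbb N}\times[-1,1]$, $\sigma$ being the left shift. For $n\ge1$ the digit $s_n(\omega,x)\in\{-1,0,1\}$ is the $d$ such that $T_{\alpha,\omega_n}(y)=2y-d\alpha$ is the branch applied at $y=T_{\alpha,\omega_{n-1}}\circ\cdots\circ T_{\alpha,\omega_1}(x)$ (with $y=x$ for $n=1$); then $x=\alpha\sum_{n\ge1}s_n(\omega,x)2^{-n}$. Let $\lambda$ be Lebesgue measure on $[-1,1]$ and $m_p$ the Bernoulli measure on $\Omega^{\mathbb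 N}$ giving the symbol $0$ probability $p$ and the symbol $1$ probability $1-p$. There is a unique $R_\alpha$-invariant probability measure of the form $m_p\times\mu_p$ with $\mu_p\ll\lambda$, and it is ergodic. With $I_2=[-\frac12,\frac{1-\alpha}2]$, $I_3=(\frac{1-\alpha}2,\frac{\alpha-1}2)$, $I_4=[\frac{\alpha-1}2,\frac12]$, the number $\pi_0(\alpha,p)$ is given by $\pi_0(\alpha,p)=(1-p)\mu_p(I_2)+\mu_p(I_3)+p\,\mu_p(I_4)$, which is the frequency of the digit $0$ for $m_p\times\mu_p$-almost every $(\omega,x)$ (by Birkhoff's Ergodic Theorem). *)

(* Defs.v *)
From HB Require Import structures.
From mathcomp Require Import all_boot all_order all_algebra.
From mathcomp Require Import all_classical all_reals all_analysis.

Set Implicit Arguments.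
Unset Strict Implicit.
Unset Printing Implicit Defensive.

Import Order.TTheory GRing.Theory Num.Theory.
Import numFieldNormedType.Exports.

Local Open Scope classical_set_scope.
Local Open Scope ring_scope.

(* The symbols 0 and 1 of Omega = {0,1} are [false] and [true].  Sequences are
   indexed from 0, so that omega_n of the usual 1-based notation is [w n.-1]. *)

Definition coordinate_sets : set_system (nat -> bool) :=
  [set A | exists (n : nat) (b : bool), A = [set w | w n = b]].

Definition coin_space := g_sigma_algebraType coordinate_sets.

Section SymmetricDoubling.
Context {R : realType}.
Implicit Types (p a x : R) (w : coin_space).

(* The cylinders form a pi-system generating the product sigma-algebra, so
   this determines the measure. *)
Definition is_bernoulli_measure p (m : probability coin_space R) : Prop :=
  forall u : seq bool,
    m [set w | forall k, (k < size u)%N -> w k = nth false u k] =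
    (\prod_(b <- u) (if b then 1 - p else p))%:E.

Definition symm_itv : set (measurableTypeR R) := `[-1, 1]%classic.

Lemma measurable_symm_itv : measurable symm_itv.
Proof. exact: measurable_itv. Qed.

Lemma lebesgue_symm_itv_lty : (lebesgue_measure symm_itv < +oo)%E.
Proof.
by rewrite /symm_itv lebesgue_measure_itv; case: ifP => _; rewrite -?EFinD ltry.
Qed.

Definition lebesgueI : {finite_measure set (measurableTypeR R) -> \bar R} :=
  mfrestr measurable_symm_itv lebesgue_symm_itv_lty.

(* Only the values on [-1, 1] matter. *)
Definition T a (b : bool) x : R :=
  if b then
    if x < - (1 / 2) then 2 * x + a
    else if x < (a - 1) / 2 then 2 * x
    else 2 * x - a
  else
    if x <= (1 - a) / 2 then 2 * x + a
    else if x <= 1 / 2 then 2 * x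
    else 2 * x - a.

Definition branch_digit a (b : bool) x : int :=
  if b then
    if x < - (1 / 2) then (-1)%R
    else if x < (a - 1) / 2 then 0
    else 1
  else
    if x <= (1 - a) / 2 then (-1)%R
    else if x <= 1 / 2 then 0
    else 1.

Lemma T_branch_digit a b x : T a b x = 2 * x - (branch_digit a b x)%:~R * a.
Proof.
rewrite /T /branch_digit.
by case: b; case: ifP => _; [|case: ifP => _| |case: ifP => _];
  rewrite ?mulrN1z ?mulN1r ?opprK ?mul0r ?subr0 ?mul1r.
Qed.

Definition random_doubling a (z : coin_space * measurableTypeR R) :
    coin_space * measurableTypeR R :=
  ((fun n => z.1 n.+1) : coin_space, T a (z.1 0%N) z.2).

Fixpoint orbit a w x (n : nat) : R :=
  if n is n'.+1 then T a (w n') (orbit a w x n') else x.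

(* [digit a w x n] is s_{n+1}(omega, x). *)
Definition digit a w x (n : nat) : int := branch_digit a (w n) (orbit a w x n).

Definition zero_freq a w x (n : nat) : R :=
  #|[set k : 'I_n | digit a w x k == 0]|%:R / n%:R.

(* [mu] is absolutely continuous with respect to Lebesgue measure on [-1, 1],
   which also makes it a measure carried by [-1, 1]. *)
Definition is_acim a (m : probability coin_space R)
    (mu : probability (measurableTypeR R) R) : Prop :=
  (mu `<< lebesgueI) /\
  forall A : set (coin_space * measurableTypeR R), measurable A ->
    (m \x mu)%E (random_doubling a @^-1` A) = (m \x mu)%E A.

Definition pi0_of a p (mu : probability (measurableTypeR R) R) : R :=
  (1 - p) * fine (mu `[- (1 / 2), (1 - a) / 2]%classic)
  + fine (mu `](1 - a) / 2, (a - 1) / 2[%classic)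
  + p * fine (mu `[(a - 1) / 2, 1 / 2]%classic).

End SymmetricDoubling.

(* Main.v *)
(* Writing an orbit point as alpha * (v - sheet) with v in [0, 1) and sheet in
   {0, 1}, the coordinate v follows the doubling map, so that its binary digits
   are independent fair bits, independent of the coins.  Only the sheet depends
   on the random choices: if the leading bit b of v equals the sheet, the new
   sheet is a function r of the coin and of the next value of v; otherwise the
   sheet does not change.  The digit is 0 exactly when b = sheet = r.

   Since b is fair and independent of r, two orbits over the same v and the same
   coins merge with probability 1/2 at each step.  Hence the digit is, up to an
   event of arbitrarily small probability, a function of finitely many
   consecutive (bit, coin) letters, and the second-moment strong law for such
   functions gives almost sure convergence of the frequency to a constant.  The
   constant is at most 1/2 because the digit 0 forces b = r.  For an invariant
   mu << lambda, dominated convergence identifies the constant with the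
   mu-probability of the digit 0. *)

Require Import Defs.
From mathcomp Require Import all_boot all_order all_algebra.
From mathcomp Require Import all_classical all_reals all_analysis.
From mathcomp Require Import measurable_realfun.
From mathcomp Require Import ring lra zify.

Import Order.TTheory GRing.Theory Num.Theory.
Import numFieldNormedType.Exports.

Local Open Scope classical_set_scope.
Local Open Scope ring_scope.

Set Implicit Arguments.
Unset Strict Implicit.
Unset Printing Implicit Defensive.

(** * Expectation over independent letters *)

(** The first component is a binary digit of the doubling coordinate, the second a coin. *)
Definition letter := (bool * bool)%type.

Definition scons (l : letter) (s : nat -> letter) : nat -> letter :=
  fun k => if k is k'.+1 then s k' else l.

Definition shift (n : nat) (s : nat -> letter) : nat -> letter :=
  fun k => s (n + k)%N.

Definition depends_on {A : Type} (n : nat) (f : (nat -> letter) -> A) :=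
  forall s s', (forall k, (k < n)%N -> s k = s' k) -> f s = f s'.

Lemma depends_on_scons A n (f : (nat -> letter) -> A) l :
  depends_on n.+1 f -> depends_on n (fun s => f (scons l s)).
Proof. by move=> df s s' ss'; apply: df => -[|k]//=; exact: ss'. Qed.

Lemma depends_on_shift A n k (f : (nat -> letter) -> A) :
  depends_on n f -> depends_on (k + n) (fun s => f (shift k s)).
Proof. by move=> df s s' ss'; apply: df => i ik; rewrite /shift ss' ?ltn_add2l. Qed.

Lemma depends_on_le A n m (f : (nat -> letter) -> A) :
  (n <= m)%N -> depends_on n f -> depends_on m f.
Proof. by move=> nm df s s' ss'; apply: df => k kn; apply: ss'; exact: leq_trans nm. Qed.

Lemma shift0 s : shift 0 s = s.
Proof. by []. Qed.

Lemma shiftD m n s : shift m (shift n s) = shift (n + m) s.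
Proof. by apply/funext => k; rewrite /shift addnA. Qed.

Section Expectation.
Context {R : realType}.
Variable p : R.
Implicit Types (f g F G : (nat -> letter) -> R) (s : nat -> letter).

Definition letter_weight (l : letter) : R := 2^-1 * (if l.2 then 1 - p else p).

(** All letters from position [n] on are frozen at the default [(false, false)], so this is the
    expectation of [F] under the product law as soon as [F] depends on the first [n] letters
    only. *)
Fixpoint expect (n : nat) F : R :=
  if n is n'.+1 then
    \sum_(l : letter) letter_weight l * expect n' (fun s => F (scons l s))
  else F (fun=> (false, false)).

Lemma sum_letter (f : letter -> R) :
  \sum_l f l = f (true, true) + f (true, false) + f (false, true) + f (false, false).
Proof.
rewrite (eq_bigr (fun l => f (l.1, l.2))); last by case.
rewrite -(pair_big xpredT xpredT (fun a b => f (a, b)))/= !big_bool/=.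
by rewrite !addrA.
Qed.

Lemma sum_letter_weight : \sum_l letter_weight l = 1.
Proof. by rewrite sum_letter /letter_weight/=; field. Qed.

Lemma expect_cst n (c : R) : expect n (fun=> c) = c.
Proof.
elim: n => //= n IH.
by under eq_bigr do rewrite IH; rewrite -mulr_suml sum_letter_weight mul1r.
Qed.

Lemma expectD n F G : expect n (fun s => F s + G s) = expect n F + expect n G.
Proof.
elim: n F G => //= n IH F G.
by rewrite -big_split/=; apply: eq_bigr => l _; rewrite IH mulrDr.
Qed.

Lemma expectZ n (c : R) F : expect n (fun s => c * F s) = c * expect n F.
Proof.
elim: n F => //= n IH F.
by rewrite mulr_sumr; apply: eq_bigr => l _; rewrite IH mulrCA.
Qed.

Lemma expectB n F G : expect n (fun s => F s - G s) = expect n F - expect n G.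
Proof.
rewrite -[- expect n G]mulN1r -expectZ -expectD.
by congr expect; apply/funext => s; rewrite mulN1r.
Qed.

Lemma expect_sum n m (F : nat -> (nat -> letter) -> R) :
  expect n (fun s => \sum_(i < m) F i s) = \sum_(i < m) expect n (F i).
Proof.
elim: m => [|m IH].
  by rewrite big_ord0 -[RHS](expect_cst n); congr expect; apply/funext => s; rewrite big_ord0.
rewrite big_ord_recr/= -IH -expectD.
by congr expect; apply/funext => s; rewrite big_ord_recr.
Qed.

Lemma expect_depends n k F : depends_on n F -> expect (n + k) F = expect n F.
Proof.
elim: n F => [|n IH] F dF.
  rewrite -[RHS](expect_cst (0 + k)); congr expect; apply/funext => s.
  exact: dF.
rewrite addSn/=; apply: eq_bigr => l _; rewrite IH//; exact: depends_on_scons.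
Qed.

(** Independence of disjoint blocks: [F] reads the letters before [n], the other factor only those
    from [n] on. *)
Lemma expect_mul_shift n k F G : depends_on n F ->
  expect (n + k) (fun s => F s * G (shift n s)) = expect n F * expect k G.
Proof.
elim: n F => [|n IH] F dF.
  rewrite add0n/= -expectZ; congr expect; apply/funext => s; rewrite shift0.
  by congr (_ * _); exact: dF.
rewrite addSn/= mulr_suml; apply: eq_bigr => l _; rewrite -mulrA -IH//.
exact: depends_on_scons.
Qed.

Lemma expect_shift n k G : expect (n + k) (fun s => G (shift n s)) = expect k G.
Proof.
rewrite -[RHS]mul1r -(expect_cst n 1) -expect_mul_shift//.
by congr expect; apply/funext => s; rewrite mul1r.
Qed.

Hypothesis p01 : 0 <= p <= 1.

Lemma letter_weight_ge0 l : 0 <= letter_weight l.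
Proof.
move/andP: p01 => [p0 p1].
by rewrite /letter_weight; case: ifP => _; rewrite mulr_ge0 ?invr_ge0// subr_ge0.
Qed.

Lemma le_expect n F G : (forall s, F s <= G s) -> expect n F <= expect n G.
Proof.
elim: n F G => //= n IH F G FG; apply: ler_sum => l _.
by rewrite ler_wpM2l ?letter_weight_ge0// IH.
Qed.

(* The first bit is fair and independent of the first coin and of all later
   letters, so it agrees with [r] half of the time. *)
Lemma expect_bit_match n (r : bool -> (nat -> letter) -> bool) G :
  expect n.+1 (fun s => (r (s 0%N).2 (shift 1 s) == (s 0%N).1)%:R * G (shift 1 s))
  = 2^-1 * expect n G.
Proof.
pose e c b := expect n (fun s => (r c s == b)%:R * G s).
have H c : e c true + e c false = expect n G.
  rewrite /e -expectD; congr expect; apply/funext => s.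
  by case: (r c s) => /=; rewrite mul1r mul0r ?addr0 ?add0r.
transitivity (\sum_(l : letter) letter_weight l * e l.2 l.1); first by [].
rewrite sum_letter /letter_weight/=.
transitivity (2^-1 * ((1 - p) * (e true true + e true false) +
                      p * (e false true + e false false))); first by ring.
by rewrite !H; ring.
Qed.

End Expectation.

(** * Variance and Chebyshev bound for sums of a function of [W] consecutive letters *)

Section Variance.
Context {R : realType}.
Variables (p : R) (W : nat) (f : (nat -> letter) -> R).
Hypothesis fW : depends_on W f.

Definition centered_sum (n : nat) (s : nat -> letter) : R :=
  \sum_(i < n) (f (shift i s) - expect p W f).

Lemma depends_on_centered_sum n : depends_on (n + W) (centered_sum n).
Proof.
move=> s s' ss'; apply: eq_bigr => i _; congr (_ - _); apply: fW => k kW.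
by apply: ss'; have := ltn_ord i; lia.
Qed.

Hypotheses (p01 : 0 <= p <= 1) (f01 : forall s, 0 <= f s <= 1).

Let g s : R := f s - expect p W f.

Let gW : depends_on W g.
Proof. by move=> s s' /fW; rewrite /g => ->. Qed.

Let norm_g s : `|g s| <= 1.
Proof.
have e0 : 0 <= expect p W f.
  by rewrite -[leLHS](expect_cst p W) le_expect// => s'; case/andP: (f01 s').
have e1 : expect p W f <= 1.
  by rewrite -[leRHS](expect_cst p W) le_expect// => s'; case/andP: (f01 s').
by case/andP: (f01 s) => ? ?; rewrite ler_norml /g; lra.
Qed.

Let expect_g : expect p W g = 0.
Proof. by rewrite /g expectB expect_cst subrr. Qed.

(** For [W <= i] the two factors read disjoint blocks and have mean zero; for [i < W] the bound 1 on
    [g] suffices. *)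
Let covariance_le n i : (i < n)%N ->
  expect p (n.+1 + W) (fun s => g s * g (shift i.+1 s)) <= (i < W)%:R.
Proof.
move=> ltin; case: ltnP => Wi.
  rewrite -[leRHS](expect_cst p (n.+1 + W)); apply: le_expect => // s.
  by rewrite (le_trans (ler_norm _))// normrM mulr_ile1.
have -> : (n.+1 + W = i.+1 + W + (n - i))%N by lia.
rewrite expect_depends; last first.
  move=> s s' ss'; congr (_ * _); first by apply: gW => k kW; apply: ss'; lia.
  by apply: (depends_on_shift (k := i.+1) gW); exact: ss'.
by rewrite expect_mul_shift ?expect_g ?mulr0//; exact: (depends_on_le (leqW Wi) gW).
Qed.

Let sum_ltn n : \sum_(i < n) (i < W)%:R <= W%:R :> R.
Proof.
suff -> : \sum_(i < n) (i < W)%:R = (minn n W)%:R :> R by rewrite ler_nat geq_minr.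
elim: n => [|n IH]; first by rewrite big_ord0 min0n.
by rewrite big_ord_recr/= IH -natrD; congr (_%:R); case: ltnP; lia.
Qed.

(** Peeling off the first term adds its square, at most 1 on average, and twice its covariances with
    the later terms. At most [W] of these are not bounded by 0, so each step costs at most
    [2 * W + 1]. *)
Lemma variance_le n :
  expect p (n + W) (fun s => centered_sum n s ^+ 2) <= (2 * W + 1)%:R * n%:R.
Proof.
elim: n => [|n IH].
  rewrite mulr0 (_ : (fun s => _) = fun=> 0) ?expect_cst//.
  by apply/funext => s; rewrite /centered_sum big_ord0 expr0n.
pose cross s := \sum_(i < n) (g s * g (shift i.+1 s)).
have Vsq s : centered_sum n.+1 s ^+ 2 =
    g s ^+ 2 + 2 * cross s + centered_sum n (shift 1 s) ^+ 2.
  rewrite /cross -mulr_sumr /centered_sum big_ord_recl/= shift0 -/(g s).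
  under eq_bigr do rewrite -/(g _).
  under [\sum_(i < n) (f (shift i (shift 1 s)) - _)]eq_bigr do rewrite shiftD -/(g _).
  by ring.
have -> : (fun s => centered_sum n.+1 s ^+ 2) = (fun s =>
    g s ^+ 2 + 2 * cross s + centered_sum n (shift 1 s) ^+ 2) by apply/funext.
rewrite !expectD expectZ.
have E1 : expect p (n.+1 + W) (fun s => g s ^+ 2) <= 1.
  rewrite -[leRHS](expect_cst p (n.+1 + W)); apply: le_expect => // s.
  by rewrite -real_normK ?num_real// exprn_ile1.
have E2 : expect p (n.+1 + W) cross <= W%:R.
  rewrite (expect_sum p _ _ (fun i s => g s * g (shift i.+1 s))).
  apply: le_trans (sum_ltn n).
  by apply: ler_sum => i _; exact: covariance_le.
have E3 : expect p (n.+1 + W) (fun s => centered_sum n (shift 1 s) ^+ 2) <=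
    (2 * W + 1)%:R * n%:R.
  by rewrite -[(n.+1 + W)%N]/(1 + (n + W))%N
    (expect_shift p 1 (n + W) (fun s => centered_sum n s ^+ 2)).
rewrite (le_trans (lerD (lerD E1 (ler_wpM2l _ E2)) E3))//.
by rewrite -[n.+1]addn1 !natrD; lra.
Qed.

Lemma chebyshev_centered_sum n (t : R) : 0 < t ->
  expect p (n + W) (fun s => (t <= `|centered_sum n s|)%R%:R) <=
  (2 * W + 1)%:R * n%:R / t ^+ 2.
Proof.
move=> t0; rewrite ler_pdivlMr ?exprn_gt0// mulrC -expectZ.
apply: le_trans (variance_le n); apply: le_expect => // s.
case: (leP t) => [tV|_]; rewrite ?mulr0 ?sqr_ge0// mulr1.
by rewrite -[leRHS]real_normK ?num_real// lerXn2r ?nnegrE//; exact: ltW.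
Qed.

(** This Lipschitz bound carries the law from the times [k ^ 2] to all times. *)
Lemma norm_centered_sumB n m s :
  `|centered_sum (n + m) s - centered_sum n s| <= m%:R.
Proof.
rewrite /centered_sum big_split_ord/= addrAC subrr add0r.
apply: le_trans (ler_norm_sum _ _ _) _.
rewrite -[leRHS]mulr1 mulr_natl -[X in _ *+ X]card_ord -sumr_const ler_sum// => i _.
exact: norm_g.
Qed.

End Variance.

(** * Window approximations of the digits *)

Section Windows.
Context {R : realType}.
Variables (p a : R).
Implicit Types (s : nat -> letter) (t v : R).

(* [reset v c] is the sheet of the image point when the leading bit of its
   antecedent equals the sheet: it depends on the coin [c] and on the coordinate
   [v] of the image, but not on the sheet that is left. *)
Definition reset v (c : bool) : bool :=
  if c then a - 1 <= a * v else 1 < a * v.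

Fixpoint binary_trunc (K : nat) s : R :=
  if K is K'.+1 then ((s 0%N).1%:R + binary_trunc K' (shift 1 s)) / 2 else 0.

(** The threshold [t] lies in the dyadic interval of the first [K] bits, so these bits do not settle
    on which side of [t] the coordinate falls. *)
Definition straddles (K : nat) t s : bool :=
  binary_trunc K s <= t < binary_trunc K s + 2^-1 ^+ K.

Definition reset_trunc (K : nat) s : bool :=
  reset (binary_trunc K (shift 1 s)) (s 0%N).2.

(** With leading bit [b] and reset value [r]: if [r = b], each of the two sheets is kept; if
    [r <> b], both go to the sheet other than [b] and merge. *)
Definition bit_match (K : nat) s : bool := reset_trunc K s == (s 0%N).1.

(** The initial sheet [false] is arbitrary; a merge makes the choice irrelevant. *)
Fixpoint sheet_trunc (K : nat) s (n : nat) : bool :=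
  if n is n'.+1 then
    if (s n').1 == sheet_trunc K s n' then reset_trunc K (shift n' s)
    else sheet_trunc K s n'
  else false.

Fixpoint no_merge (K n : nat) s : bool :=
  if n is n'.+1 then bit_match K s && no_merge K n' (shift 1 s) else true.

(** The two thresholds are the values of [v] at which [reset v] jumps, for the coins [true] and
    [false] respectively. *)
Definition ambiguous (K : nat) s : bool :=
  straddles K ((a - 1) / a) s || straddles K (1 / a) s.

(** A guess for the event that the digit at position [M] is 0: the [M] letters before it serve to
    determine the sheet, and each reset is computed from [2 * M] bits. *)
Definition zero_window (M : nat) s : bool :=
  bit_match (2 * M) (shift M s) && (sheet_trunc (2 * M) s M == (s M).1).

Definition bad_window (M : nat) s : bool :=
  no_merge (2 * M) M s || [exists k : 'I_M.+1, ambiguous (2 * M) (shift k.+1 s)].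

Definition window_size (M : nat) : nat := (M.+1 + 2 * M)%N.

Lemma depends_on_binary_trunc K : depends_on K (binary_trunc K).
Proof.
elim: K => // K IH s s' ss' /=; rewrite (ss' 0%N)//.
by rewrite (IH _ (shift 1 s'))// => k kK; exact: ss'.
Qed.

Lemma depends_on_straddles K t : depends_on K (straddles K t).
Proof. by move=> s s' /depends_on_binary_trunc; rewrite /straddles => ->. Qed.

Lemma depends_on_reset_trunc K : depends_on K.+1 (reset_trunc K).
Proof.
move=> s s' ss'; rewrite /reset_trunc (ss' 0%N)//.
by rewrite (depends_on_binary_trunc (s' := shift 1 s'))// => k kK; exact: ss'.
Qed.

Lemma depends_on_bit_match K : depends_on K.+1 (bit_match K).
Proof.
by move=> s s' ss'; rewrite /bit_match (depends_on_reset_trunc ss') (ss' 0%N).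
Qed.

Lemma depends_on_sheet_trunc K n : depends_on (n + K) (fun s => sheet_trunc K s n).
Proof.
elim: n => // n IH s s' ss' /=.
rewrite (IH s s'); last by move=> k kn; apply: ss'; lia.
rewrite (ss' n) ?ltn_addr//.
have -> // : reset_trunc K (shift n s) = reset_trunc K (shift n s').
by apply: (depends_on_shift (k := n) (@depends_on_reset_trunc K)) => k kn; apply: ss'; lia.
Qed.

Lemma depends_on_no_merge K n : depends_on (n + K) (no_merge K n).
Proof.
elim: n => // n IH s s' ss' /=; congr (_ && _).
  by apply: depends_on_bit_match => k kK; apply: ss'; lia.
by apply: IH => k kn; apply: ss'; rewrite add1n addSn.
Qed.

Lemma depends_on_zero_window M : depends_on (window_size M) (zero_window M).
Proof.
move=> s s' ss'; rewrite /zero_window; congr (_ && _).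
  apply: (depends_on_shift (k := M) (@depends_on_bit_match _)) => k kM.
  by apply: ss'; rewrite /window_size; lia.
rewrite (depends_on_sheet_trunc (s' := s')); last first.
  by move=> k kM; apply: ss'; rewrite /window_size; lia.
by rewrite ss'// /window_size; lia.
Qed.

Lemma depends_on_bad_window M : depends_on (window_size M) (bad_window M).
Proof.
move=> s s' ss'; rewrite /bad_window; congr (_ || _).
  by apply: depends_on_no_merge => k kM; apply: ss'; rewrite /window_size; lia.
apply: eq_existsb => k; rewrite /ambiguous; congr (_ || _);
  apply: (depends_on_shift (k := k.+1) (@depends_on_straddles _ _)) => i ik;
  by apply: ss'; rewrite /window_size; have := ltn_ord k; lia.
Qed.

Lemma no_mergeP K n s : ~~ no_merge K n s ->
  exists2 k, (k < n)%N & ~~ bit_match K (shift k s).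
Proof.
elim: n s => //= n IH s; rewrite negb_and => /orP[nm|/IH[k kn]]; first by exists 0%N.
by rewrite shiftD; exists k.+1.
Qed.

(** * Probabilities of the window events *)

Hypothesis p01 : 0 <= p <= 1.

(** Fixing the first bit [b] turns [t] into [2 * t - b], and for [t] in [0, 1) exactly one of the
    two choices stays in [0, 1); each bit thus contributes a factor 1/2. *)
Lemma expect_straddles K t :
  expect p K (fun s => (straddles K t s)%:R) <= 2^-1 ^+ K * (0 <= t < 1)%R%:R.
Proof.
elim: K t => [|K IH] t; first by rewrite /straddles/= expr0 add0r mul1r.
have E (l : letter) s : straddles K.+1 t (scons l s) = straddles K (2 * t - l.1%:R) s.
  rewrite /straddles/= exprS.
  change (shift 1 (scons l s)) with s.
  by apply/andP/andP => -[? ?]; split; lra.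
rewrite /=; apply: (@le_trans _ _ (\sum_(l : letter) letter_weight p l *
    (2^-1 ^+ K * (0 <= 2 * t - l.1%:R < 1)%R%:R))).
  apply: ler_sum => l _; rewrite ler_wpM2l ?letter_weight_ge0//.
  by apply: le_trans (IH _); apply: le_expect => // s; rewrite E.
rewrite sum_letter /letter_weight/= exprS.
have -> : (0 <= t < 1) = (0 <= 2 * t - 1 < 1) || (0 <= 2 * t - 0 < 1).
  by apply/idP/idP; [case/andP|case/orP => /andP[]] => *; lra.
have : ~~ ((0 <= 2 * t - 1 < 1) && (0 <= 2 * t - 0 < 1)) by apply/negP; lra.
by case: (0 <= _ < _); case: (0 <= _ < _) => //= _; rewrite ?mulr0; lra.
Qed.

Lemma expect_bit_match_half K : expect p K.+1 (fun s => (bit_match K s)%:R) = 2^-1.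
Proof.
rewrite -[RHS]mulr1 -[X in _ * X](expect_cst p K).
rewrite -(expect_bit_match p K (fun c s => reset (binary_trunc K s) c)).
by congr expect; apply/funext => s; rewrite mulr1.
Qed.

(** The matching events overlap in the letters they read, yet the probabilities multiply: the first
    bit is fresh with respect to its reset value and to all later matches. *)
Lemma expect_no_merge K n : expect p (n + K) (fun s => (no_merge K n s)%:R) = 2^-1 ^+ n.
Proof.
elim: n => [|n IH]; first by rewrite expect_cst expr0.
rewrite exprS -IH addSn.
rewrite -(expect_bit_match p _ (fun c s => reset (binary_trunc K s) c)).
by congr expect; apply/funext => s; rewrite -natrM mulnb.
Qed.

(** This is the source of the constant 1/2: the event requires a bit match, and a fair bit matches
    with probability 1/2. *)
Lemma expect_zero_window M : expect p (window_size M) (fun s => (zero_window M s)%:R) <= 1 / 2.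
Proof.
apply: (@le_trans _ _ (expect p (M + (2 * M).+1) (fun s => (bit_match (2 * M) (shift M s))%:R))).
  rewrite /window_size addSnnS; apply: le_expect => // s.
  by rewrite /zero_window; case: bit_match => //=; case: eqP.
by rewrite (expect_shift p M _ (fun s => (bit_match _ s)%:R)) expect_bit_match_half; lra.
Qed.

(** Union bound. Not merging has probability [2^-1 ^+ M]; each of the two thresholds contributes at
    most [M.+1] times [2^-1 ^+ (2 * M)], which is at most [2^-1 ^+ M] because [M.+1 <= 2 ^ M]. *)
Lemma expect_bad_window M :
  expect p (window_size M) (fun s => (bad_window M s)%:R) <= 3 * 2^-1 ^+ M.
Proof.
set N := window_size M; set K := (2 * M)%N.
pose amb t k s : R := (straddles K t (shift k.+1 s))%:R.
pose t1 := (a - 1) / a; pose t2 := 1 / a.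
have H s : (bad_window M s)%:R <= (no_merge K M s)%:R +
    (\sum_(k < M.+1) amb t1 k s + \sum_(k < M.+1) amb t2 k s).
  rewrite -big_split/= /bad_window.
  have S0 : 0 <= \sum_(k < M.+1) (amb t1 k s + amb t2 k s).
    by apply: sumr_ge0 => k _; rewrite addr_ge0.
  case: no_merge => /=; first by rewrite lerDl.
  rewrite add0r; case: existsP => //= -[k] kamb.
  rewrite (bigD1 k)//= (@le_trans _ _ (amb t1 k s + amb t2 k s))//; last first.
    by rewrite lerDl; apply: sumr_ge0 => j _; rewrite addr_ge0.
  rewrite /amb; move: kamb; rewrite /ambiguous -/t1 -/t2 -/K.
  by case: straddles; case: straddles => //= _; rewrite ?lerDl ?lerDr.
apply: le_trans (le_expect p01 N H) _.
rewrite !expectD !(expect_sum p N M.+1 (amb _)).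
have A t : \sum_(k < M.+1) expect p N (amb t k) <= M.+1%:R * 2^-1 ^+ K.
  rewrite mulr_natl -[X in _ *+ X]card_ord -sumr_const; apply: ler_sum => k _.
  have -> : N = (k.+1 + K + (M - k))%N.
    by rewrite /N /window_size -/K; have := ltn_ord k; lia.
  rewrite expect_depends; last first.
    move=> s s' ss'; rewrite /amb; congr (nat_of_bool _)%:R.
    by apply: (depends_on_shift (k := k.+1) (@depends_on_straddles _ _)).
  rewrite (expect_shift p k.+1 K (fun s => (straddles K t s)%:R)).
  apply: le_trans (expect_straddles _ _) _.
  by case: (_ <= _ < _); rewrite ?mulr1 ?mulr0 ?exprn_ge0 ?invr_ge0.
have -> : N = (M + K + 1)%N by rewrite /N /window_size -/K; lia.
rewrite expect_depends; last by move=> s s' /depends_on_no_merge ->.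
rewrite expect_no_merge.
have B : M.+1%:R * 2^-1 ^+ K <= 2^-1 ^+ M :> R.
  rewrite /K mul2n -addnn exprD mulrA ler_piMl ?exprn_ge0 ?invr_ge0//.
  by rewrite exprVn ler_pdivrMr ?exprn_gt0// mul1r -natrX ler_nat ltn_expl.
have := A t1; have := A t2; have -> : N = (M + K + 1)%N by rewrite /N /window_size -/K; lia.
lra.
Qed.

End Windows.

(** * The orbit as a doubling orbit together with a sheet *)

Section SheetDynamics.
Context {R : realType}.
Variable a : R.
Hypothesis a1 : 1 <= a.

(** Here [z] stands for [a] times the image coordinate; naming this product makes all comparisons
    linear once the booleans are fixed. *)
Let branch_digit_value (y z : R) (b c sheet : bool) : 0 < z < a ->
  2 * y = z + a * b%:R - 2 * a * sheet%:R ->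
  branch_digit a c y =
  (if b == sheet then (if c then (a - 1 <= z)%R else (1 < z)%R) else sheet)%:R
    + b%:R - 2 * sheet%:R :> int.
Proof.
have a1' := a1; move=> /andP[z0 za]; rewrite /branch_digit.
case: b c sheet => -[] []; rewrite ?(mulr1, mulr0, subr0, addr0) => yE /=;
  repeat match goal with
  | |- context [if (?s <= ?t)%R then _ else _] => case: (lerP s t)
  | |- context [if (?s < ?t)%R then _ else _] => case: (ltrP s t)
  | |- context [nat_of_bool (?s <= ?t)%R] => case: (lerP s t)
  | |- context [nat_of_bool (?s < ?t)%R] => case: (ltrP s t)
  | |- is_true _ -> _ => let h := fresh in move=> h
  end; try (by []); exfalso; lra.
Qed.

(** The digit [d] is forced by [2 * y - d * a = a * (v' - sheet')], where [sheet'] is the new sheet.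
    The value [v' = 0] has to be excluded: for [a = 1] and [y = 1 / 2] on sheet 0, the coin [false]
    selects the digit 0 where the formula gives 1. *)
Lemma branch_digit_sheet (v v' : R) (b c sheet : bool) :
  v' = 2 * v - b%:R -> 0 < v' < 1 ->
  branch_digit a c (a * (v - sheet%:R)) =
  (if b == sheet then reset a v' c else sheet)%:R + b%:R - 2 * sheet%:R :> int.
Proof.
move=> v'E /andP[v'0 v'1]; apply: branch_digit_value.
  by rewrite mulr_gt0 ?gtr_pMr//=; exact: lt_le_trans a1.
by rewrite v'E; ring.
Qed.

Variables (w : coin_space) (x : R).
Hypothesis x11 : -1 <= x < 1.

Definition double_step (v : R) : R := 2 * v - (1 / 2 <= v)%R%:R.

(** Adding 1 for negative [x] puts the coordinate in [0, 1); the initial sheet [x < 0] compensates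
    for it. *)
Definition double_orbit (n : nat) : R :=
  iter n double_step (x / a + (x < 0)%R%:R).

Definition letters (n : nat) : letter := (1 / 2 <= double_orbit n, w n).

Fixpoint sheet (n : nat) : bool :=
  if n is n'.+1 then
    if (letters n').1 == sheet n' then reset a (double_orbit n) (w n')
    else sheet n'
  else x < 0.

Let a0 : 0 < a. Proof. exact: lt_le_trans a1. Qed.

Lemma double_orbit_itv n : 0 <= double_orbit n < 1.
Proof.
elim: n => [|n IH].
  have a1' := a1; rewrite /double_orbit/=; case/andP: x11 => xm1 x1.
  have : -1 <= x / a < 1 by rewrite ler_pdivlMr// ltr_pdivrMr//; lra.
  case: (ltP x 0) => x0 /=.
    have : x / a < 0 by rewrite ltr_pdivrMr// mul0r.
    by lra.
  have : 0 <= x / a by rewrite divr_ge0// ltW.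
  by lra.
rewrite [double_orbit _]/= -/(double_orbit n) /double_step.
by move: (double_orbit n) IH => v; case: (lerP (1 / 2) v) => ? /andP[? ?] /=; lra.
Qed.

Lemma double_orbitS n :
  double_orbit n.+1 = 2 * double_orbit n - (letters n).1%:R.
Proof. by []. Qed.

Lemma sheetS n : sheet n.+1 =
  if (letters n).1 == sheet n then reset a (double_orbit n.+1) (w n) else sheet n.
Proof. by []. Qed.

Lemma binary_trunc_double_orbit K n :
  binary_trunc K (shift n letters) <= double_orbit n <
  binary_trunc K (shift n letters) + 2^-1 ^+ K.
Proof.
elim: K n => [|K IH] n; first by rewrite /= expr0 add0r double_orbit_itv.
have -> : binary_trunc K.+1 (shift n letters) =
    ((letters n).1%:R + binary_trunc K (shift n.+1 letters)) / 2.
  by rewrite /= shiftD addn1 /shift addn0.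
rewrite exprS; have := IH n.+1; rewrite double_orbitS.
by move=> /andP[? ?]; apply/andP; split; lra.
Qed.

(** The coordinate and its truncation lie in the same dyadic interval, which contains no threshold,
    so both fall on the same side. *)
Lemma reset_trunc_double_orbit K n : ~~ ambiguous a K (shift n.+1 letters) ->
  reset_trunc a K (shift n letters) = reset a (double_orbit n.+1) (w n).
Proof.
rewrite /reset_trunc shiftD addn1.
have -> : shift n letters 0%N = letters n by rewrite /shift addn0.
rewrite /ambiguous /straddles negb_or /reset [(letters n).2]/=.
have := binary_trunc_double_orbit K n.+1.
move: (binary_trunc _ _) (double_orbit n.+1) => q v /andP[qv vq] /andP[+ +].
rewrite ler_pdivlMr// ltr_pdivrMr// ler_pdivlMr// ltr_pdivrMr//.
have aqv : a * q <= a * v by rewrite ler_pM2l.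
have avq : a * v < (q + 2^-1 ^+ K) * a by rewrite mulrC ltr_pM2r.
rewrite ![q * a]mulrC => H1 H2; case: (w n); apply/idP/idP => H.
- exact: le_trans aqv.
- move: H1; apply: contraNT; rewrite -ltNge => /ltW ->/=; exact: le_lt_trans avq.
- exact: lt_le_trans aqv.
- move: H2; apply: contraNT; rewrite -leNgt => ->/=; exact: lt_trans avq.
Qed.

(** After a failed match the true sheet and the one started from [false] agree, and from then on
    both follow the same rule. *)
Lemma sheet_merge K n m :
  (forall k, (k < m)%N -> ~~ ambiguous a K (shift (n + k).+1 letters)) ->
  (exists2 k, (k < m)%N & ~~ bit_match a K (shift (n + k) letters)) ->
  sheet (n + m) = sheet_trunc a K (shift n letters) m.
Proof.
elim: m => [|m IH] namb [k]; first by rewrite ltn0.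
rewrite ltnS leq_eqVlt addnS => km nmatch.
have E : reset_trunc a K (shift m (shift n letters)) =
    reset a (double_orbit (n + m).+1) (w (n + m)%N).
  by rewrite shiftD reset_trunc_double_orbit// namb.
have -> : sheet_trunc a K (shift n letters) m.+1 =
    if (letters (n + m)).1 == sheet_trunc a K (shift n letters) m
    then reset a (double_orbit (n + m).+1) (w (n + m)%N)
    else sheet_trunc a K (shift n letters) m by rewrite -E.
rewrite sheetS; case/predU1P: km nmatch => [->|km] nmatch; last first.
  by rewrite IH//; [move=> j jm; apply: namb; exact: ltnW|exists k].
(* The match fails at the last step: both sheets move to the negation of the bit, whatever they
   were. *)
move: nmatch; rewrite /bit_match -shiftD E {1}/shift addn0.
by case: (reset _ _ _) (letters _).1 (sheet _) (sheet_trunc _ _ _ _) => -[] [] [].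
Qed.

Hypothesis double_orbit_gt0 : forall n, 0 < double_orbit n.

Let double_orbit_oo n : 0 < double_orbit n < 1.
Proof. by rewrite double_orbit_gt0; case/andP: (double_orbit_itv n). Qed.

Lemma orbit_sheet n : Defs.orbit a w x n = a * (double_orbit n - (sheet n)%:R).
Proof.
elim: n => [|n IH].
  by rewrite /= /double_orbit/= addrK mulrC divfK// gt_eqF.
rewrite [Defs.orbit _ _ _ _]/= IH T_branch_digit.
rewrite (branch_digit_sheet _ _ (double_orbitS n))// double_orbitS [sheet n.+1]/=.
by case: ifP => _; rewrite !(rmorphB, rmorphD, rmorphM)/= !mulrz_nat; ring.
Qed.

(** If bit and sheet agree, the digit is the reset value minus the bit; otherwise it is the bit
    minus the sheet, which is nonzero. *)
Lemma digit_eq0 n : (digit a w x n == 0) =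
  ((letters n).1 == sheet n) && (reset a (double_orbit n.+1) (w n) == (letters n).1).
Proof.
rewrite /digit orbit_sheet (branch_digit_sheet _ _ (double_orbitS n))//.
by case: (letters n).1 (sheet n) (reset _ _ _) => -[] [].
Qed.

Lemma digit_zero_window M n : ~~ bad_window a M (shift n letters) ->
  (digit a w x (n + M) == 0) = zero_window a M (shift n letters).
Proof.
rewrite /bad_window negb_or => /andP[merge]; rewrite negb_exists => /forallP namb.
have {}namb k : (k <= M)%N -> ~~ ambiguous a (2 * M) (shift (n + k).+1 letters).
  by move=> kM; have := namb (Ordinal (kM : (k < M.+1)%N)); rewrite shiftD addnS.
rewrite digit_eq0 (sheet_merge (K := 2 * M)); first last.
- by have [k kM nmatch] := no_mergeP merge; exists k; rewrite -?shiftD.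
- by move=> k /ltnW; exact: namb.
rewrite /zero_window /bit_match shiftD reset_trunc_double_orbit; last exact: namb.
have -> : shift (n + M) letters 0%N = letters (n + M) by rewrite /shift addn0.
by rewrite andbC [_ == (letters _).1 as X in _ && X]eq_sym.
Qed.

End SheetDynamics.

(** * Strong law for window functions *)

Lemma sqrt_sandwich (n : nat) : exists2 k, (k ^ 2 <= n)%N & (n <= k ^ 2 + 2 * k)%N.
Proof.
elim: n => [|n [k kn nk]]; first by exists 0%N.
have [?|?] := leqP (k.+1 ^ 2) n.+1; [exists k.+1|exists k]; move: nk kn; nia.
Qed.

Lemma sqrt_sandwich_le (K k n : nat) :
  (K.+1 ^ 2 <= n)%N -> (n <= k ^ 2 + 2 * k)%N -> (K <= k)%N.
Proof. by move=> Kn nk; rewrite leqNgt; apply/negP; move: Kn nk; nia. Qed.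

(** Between [n] and the largest square [k ^ 2] below it, [u] varies by at most [2 * k], which is
    negligible against [k ^ 2]. *)
Lemma cvg_mean_of_squares {R : realType} (u : nat -> R) :
  (forall n m, `|u (n + m)%N - u n| <= m%:R) ->
  (forall j : nat, exists K : nat, forall k, (K <= k)%N ->
     `|u (k ^ 2)%N| < j.+1%:R^-1 * (k ^ 2)%:R) ->
  u n / n%:R @[n --> \oo] --> (0 : R).
Proof.
move=> lipu smallu; apply/cvgrPdist_lt => e e0.
pose j := Num.truncn (2 / e).
have je : j.+1%:R^-1 <= e / 2.
  rewrite -[e / 2]invrK lef_pV2 ?posrE ?invr_gt0 ?divr_gt0//.
  by rewrite invf_div ltW// truncnS_gt.
have [K Ksmall] := smallu j.
(* The second bound gives [4 / e < k], hence [2 * k < e / 2 * k ^ 2]; [u] at the square takes the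
   other half of [e]. *)
pose K' := maxn K.+1 (Num.truncn (4 / e)).+1.
near=> n.
have [k kn nk] := sqrt_sandwich n.
have K'k : (K' <= k)%N.
  by apply: sqrt_sandwich_le nk; near: n; exact: nbhs_infty_ge.
have k0 : (0 < k)%N by apply: leq_trans K'k; rewrite /K' leq_max.
have n0 : (0 < n)%N by apply: leq_trans kn; rewrite expn_gt0 k0.
rewrite sub0r normrN normrM normfV normr_nat ltr_pdivrMr ?ltr0n//.
have uk : `|u (k ^ 2)%N| < e / 2 * k%:R ^+ 2.
  rewrite -natrX; apply: lt_le_trans (Ksmall k _) _.
    by apply: leq_trans K'k; rewrite /K' leq_max leqnSn.
  by rewrite ler_wpM2r.
have un : `|u n - u (k ^ 2)%N| <= 2 * k%:R.
  have -> : n = (k ^ 2 + (n - k ^ 2))%N by rewrite subnKC.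
  apply: le_trans (lipu _ _) _; rewrite -natrM ler_nat; lia.
have ke : 4 / e < k%:R.
  apply: lt_le_trans (truncnS_gt _) _; rewrite ler_nat.
  by apply: leq_trans K'k; rewrite /K' leq_max leqnn orbT.
have {}ke : 2 * k%:R < e / 2 * k%:R ^+ 2.
  move: ke; rewrite ltr_pdivrMr// => ke.
  have kR : 0 < k%:R :> R by rewrite ltr0n.
  have := mulr_gt0 kR (_ : 0 < k%:R * e - 4); rewrite subr_gt0 => /(_ ke); nra.
have kn' : k%:R ^+ 2 <= n%:R :> R by rewrite -natrX ler_nat.
have tri : `|u n| <= `|u n - u (k ^ 2)%N| + `|u (k ^ 2)%N|.
  by rewrite (le_trans _ (ler_normD _ _))// subrK.
have : e * k%:R ^+ 2 <= e * n%:R by rewrite ler_pM2l.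
lra.
Unshelve. all: by end_near. Qed.

(** * Transfer from independent letters to [m \x lebesgueI], and Borel-Cantelli *)

Section WindowLaw.
Context {R : realType}.
Variables (p a : R) (m : probability coin_space R).
Hypotheses (p01 : 0 <= p <= 1) (a1 : 1 <= a) (mp : is_bernoulli_measure p m).

Let P := (m \x @lebesgueI R)%E.

Let a0 : 0 < a. Proof. exact: lt_le_trans a1. Qed.

Definition prefix_seq (q : seq letter) (s : nat -> letter) := foldr scons s q.

Lemma prefix_seq_nth q s k :
  prefix_seq q s k = if (k < size q)%N then nth (false, false) q k else s (k - size q)%N.
Proof. by elim: q k => [|l q IH] [|k]//=; rewrite IH. Qed.

Lemma prefix_seq_letters q (s : nat -> letter) :
  (forall k, (k < size q)%N -> s k = nth (false, false) q k) ->
  s = prefix_seq q (shift (size q) s).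
Proof.
move=> sq; apply/funext => k; rewrite prefix_seq_nth; case: ltnP => kq.
  exact: sq.
by rewrite /shift subnKC.
Qed.

Lemma measurable_cylinder (u : seq bool) :
  measurable ([set w | forall k, (k < size u)%N -> w k = nth false u k] : set coin_space).
Proof.
rewrite (_ : [set w | _] = \bigcap_(k in `I_(size u)) [set w | w k = nth false u k]).
  apply: fin_bigcap_measurable => // k _.
  by apply: sub_sigma_algebra; exists k, (nth false u k).
by [].
Qed.

Lemma lebesgueI_itv_le (x y : R) : x <= y ->
  (@lebesgueI R `[x, y[%classic <= (y - x)%:E)%E.
Proof.
move=> xy; rewrite /lebesgueI /= /mfrestr /mrestr.
apply: (@le_trans _ _ (lebesgue_measure (`[x, y[%classic : set R))).
  rewrite le_measure ?inE//.
  by apply: measurableI => //; exact: measurable_symm_itv.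
by rewrite lebesgue_measure_itv/= lte_fin; case: ifP => // _; rewrite lee_fin subr_ge0.
Qed.

(* The point [x] is [a * (v - sheet)], where [v] lies in the dyadic interval
   prescribed by the bits: two intervals of length [a / 2 ^ n]. *)
Lemma cylinder_cover (q : seq letter) : exists B, [/\ measurable B,
  (forall w x, -1 <= x < 1 ->
     (forall k, (k < size q)%N -> letters a w x k = nth (false, false) q k) ->
     B (w, x)) &
  (P B <= (2 * a * \prod_(l <- q) letter_weight p l)%:E)%E].
Proof.
pose s := prefix_seq q (fun=> (false, false)).
pose t := binary_trunc (R := R) (size q) s.
pose d : R := 2^-1 ^+ size q.
pose I0 := `[a * t, a * (t + d)[%classic : set R.
pose I1 := `[a * (t - 1), a * (t - 1 + d)[%classic : set R.
pose u := [seq l.2 | l <- q].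
pose A := [set w | forall k, (k < size u)%N -> w k = nth false u k] : set coin_space.
have mA : measurable A by exact: measurable_cylinder.
have mI0 : measurable I0 by exact: measurable_itv.
have mI1 : measurable I1 by exact: measurable_itv.
have mI : measurable (I0 `|` I1) by exact: measurableU.
have d0 : 0 <= d by rewrite exprn_ge0// invr_ge0.
exists (A `*` (I0 `|` I1)); split; first exact: measurableX.
- move=> w x x11 lq; split => /=.
    move=> k; rewrite size_map => kq.
    by rewrite (nth_map (false, false))// -lq.
  have /= := binary_trunc_double_orbit a1 w x11 (size q) 0.
  rewrite shift0 -/d.
  have -> : binary_trunc (size q) (letters a w x) = t.
    apply: depends_on_binary_trunc => k kq.
    by rewrite lq// /s prefix_seq_nth kq.
  rewrite /double_orbit/=.
  have ax : x = a * (x / a) by rewrite mulrC divfK// gt_eqF.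
  move=> /andP[h1 h2]; case: (x < 0) h1 h2 => /= h1 h2; [right|left];
    rewrite /I0 /I1 /= in_itv/= ax ler_pM2l// ltr_pM2l//; lra.
- rewrite /P product_measure1E//.
  rewrite [X in (X * _)%E](_ : _ = (\prod_(b <- u) (if b then 1 - p else p))%:E);
    last exact: mp.
  have w0 : 0 <= \prod_(b <- u) (if b then 1 - p else p).
    by apply: prodr_ge0 => -[] _; have := p01; lra.
  have -> : 2 * a * \prod_(l <- q) letter_weight p l =
      (\prod_(b <- u) (if b then 1 - p else p)) * (2 * a * d).
    have -> : \prod_(l <- q) letter_weight p l =
        d * \prod_(b <- u) (if b then 1 - p else p).
      rewrite /letter_weight /d /u big_map; elim: (q) => [|l q' IH].
        by rewrite !big_nil mulr1.
      by rewrite !big_cons IH exprS; ring.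
    by ring.
  rewrite EFinM lee_wpmul2l ?lee_fin//.
  apply: (le_trans (measureU2 _ _ _)) => //.
  have -> : 2 * a * d = (a * (t + d) - a * t) + (a * (t - 1 + d) - a * (t - 1)) by ring.
  by rewrite EFinD leeD// lebesgueI_itv_le// ler_pM2l// lerDl.
Qed.

(** The prefix [q] makes the induction possible: letters are appended to it one by one until the
    window is fixed, and then the event is either covered by a cylinder or empty. *)
Lemma window_cover_prefix N (q : seq letter) (A : (nat -> letter) -> bool) :
  depends_on N (fun s => A (prefix_seq q s)) -> exists B, [/\ measurable B,
  (forall w x, -1 <= x < 1 ->
     (forall k, (k < size q)%N -> letters a w x k = nth (false, false) q k) ->
     A (letters a w x) -> B (w, x)) &
  (P B <= (2 * a * (\prod_(l <- q) letter_weight p l) *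
           expect p N (fun s => (A (prefix_seq q s))%:R))%:E)%E].
Proof.
elim: N q => [|N IH] q dA.
  have [AT|AF] := boolP (A (prefix_seq q (fun=> (false, false)))).
    have [B [mB qB PB]] := cylinder_cover q.
    exists B; split=> [//|w x x11 lq _|]; first exact: qB.
    by rewrite /= AT mulr1.
  exists set0; split=> [//|w x x11 lq|]; last by rewrite /P measure0 /= (negbTE AF) mulr0.
  by rewrite (prefix_seq_letters lq) (dA _ (fun=> (false, false)))// (negbTE AF).
have pre l s : prefix_seq (rcons q l) s = prefix_seq q (scons l s).
  by rewrite /prefix_seq foldr_rcons.
have /choice[B HB] : forall l, exists B, [/\ measurable B,
  (forall w x, -1 <= x < 1 ->
     (forall k, (k < size (rcons q l))%N ->
        letters a w x k = nth (false, false) (rcons q l) k) ->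
     A (letters a w x) -> B (w, x)) &
  (P B <= (2 * a * (\prod_(l <- rcons q l) letter_weight p l) *
           expect p N (fun s => (A (prefix_seq (rcons q l) s))%:R))%:E)%E].
  move=> l; apply: IH.
  rewrite (_ : (fun s => _) = fun s => A (prefix_seq q (scons l s))); last first.
    by apply/funext => s; rewrite pre.
  exact: (depends_on_scons l dA).
exists (\big[setU/set0]_(l : letter) B l); split.
- by apply: bigsetU_measurable => l _; have [] := HB l.
- move=> w x x11 lq Aw; rewrite -bigcup_seq; exists (letters a w x (size q)).
    by rewrite /= mem_index_enum.
  have [_ + _] := HB (letters a w x (size q)); apply => // k.
  rewrite size_rcons ltnS leq_eqVlt nth_rcons => /predU1P[->|kq].
    by rewrite ltnn eqxx.
  by rewrite kq lq.
- have -> : 2 * a * (\prod_(l <- q) letter_weight p l) *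
      expect p N.+1 (fun s => (A (prefix_seq q s))%:R) =
      \sum_(l : letter) (2 * a * (\prod_(l <- rcons q l) letter_weight p l) *
        expect p N (fun s => (A (prefix_seq (rcons q l) s))%:R)).
    rewrite [expect _ _ _]/= mulr_sumr; apply: eq_bigr => l _.
    rewrite -cats1 big_cat big_seq1 /= cats1 !mulrA; congr (_ * expect _ _ _).
    by apply/funext => s; rewrite pre.
  rewrite -sumEFin.
  have : (P (\big[setU/set0]_(l : letter) B l) <= \sum_(l : letter) P (B l))%E.
    suff [] : measurable (\big[setU/set0]_(l : letter) B l) /\
        (P (\big[setU/set0]_(l : letter) B l) <= \sum_(l : letter) P (B l))%E by [].
    apply: (big_ind2 (fun X x => measurable X /\ (P X <= x)%E)).
    - by rewrite /P measure0.
    - move=> X x Y y [mX Xx] [mY Yy]; split; first exact: measurableU.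
      by apply: le_trans (leeD Xx Yy); exact: measureU2.
    - by move=> l _; have [] := HB l.
  move=> /le_trans; apply; apply: lee_sum => l _.
  by have [] := HB l.
Qed.


(** The law of the letters is dominated by [2 * a] times the product law, [2 * a] being the length
    of [-a, a), which contains [-1, 1). Null sets of letters therefore pull back to null sets. *)
Lemma window_cover N (A : (nat -> letter) -> bool) : depends_on N A ->
  exists B, [/\ measurable B,
    (forall w x, -1 <= x < 1 -> A (letters a w x) -> B (w, x)) &
    (P B <= (2 * a * expect p N (fun s => (A s)%:R))%:E)%E].
Proof.
move=> dA; have [|B [mB BA PB]] := @window_cover_prefix N [::] A; first exact: dA.
exists B; split=> [//|w x x11|]; first exact: BA.
by move: PB; rewrite big_nil mulr1.
Qed.

(** The endpoint 1 is discarded because for [a = 1] its coordinate [x / a] would be 1. *)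
Lemma ae_symm_itv_open : {ae (m \x @lebesgueI R)%E, forall z, -1 <= z.2 < 1}.
Proof.
have mI : measurable (~` `[-1, 1[%classic : set R).
  by apply: measurableC; exact: measurable_itv.
exists (setT `*` (~` `[-1, 1[%classic)); split.
- exact: measurableX.
- rewrite product_measure1E//.
  rewrite [X in (_ * X)%E](_ : _ = 0%E) ?mule0//.
  rewrite /lebesgueI /= /mfrestr /mrestr.
  rewrite (_ : _ `&` _ = [set 1]) ?lebesgue_measure_set1//.
  apply/seteqP; split => x /=; rewrite /symm_itv /= !in_itv/=.
    move=> [/negP H /andP[x1 x2]]; move: H; rewrite x1 /= -leNgt => ?; apply/eqP.
    by rewrite eq_le x2.
  move=> ->; rewrite ltxx andbF; split=> //; rewrite lexx andbT.
  by rewrite -subr_ge0 opprK.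
- by move=> [w x]/= /negP H; split=> //; rewrite in_itv/=; exact/negP.
Qed.

(** Telescoping: [2 / x - 2 / (x + 1)] dominates the inverse square of [x] because [x + 1 <= 2 * x]
    for [x >= 1]. *)
Lemma sum_inv_square_le n : \sum_(k < n) (k.+1%:R ^+ 2)^-1 <= 2 - 2 / n.+1%:R :> R.
Proof.
elim: n => [|n IH]; first by rewrite big_ord0 divr1 subrr.
rewrite big_ord_recr/=; apply: le_trans (lerD IH (lexx _)) _.
have : 1 <= n.+1%:R :> R by rewrite ler1n.
rewrite -[n.+2%:R]natr1; move: (n.+1%:R) (ltr0Sn R n) => x x0 x1.
have : (x ^+ 2)^-1 <= 2 / x - 2 / (x + 1); last by lra.
have -> : 2 / x - 2 / (x + 1) = (x * (x + 1) / 2)^-1.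
  by field; rewrite !gt_eqF//; lra.
by rewrite lef_pV2 ?posrE ?divr_gt0 ?mulr_gt0 ?exprn_gt0 ?addr_gt0//; nra.
Qed.

Variables (W : nat) (f : (nat -> letter) -> R).
Hypotheses (fW : depends_on W f) (f01 : forall s, 0 <= f s <= 1).

Let Sum n (z : coin_space * measurableTypeR R) : R :=
  centered_sum p W f n (letters a z.1 z.2).

(** At time [k ^ 2] Chebyshev gives a probability of order [1 / k ^ 2], which is summable, and
    Borel-Cantelli applies to the covers. *)
Lemma ae_centered_sum_square (e : R) : 0 < e ->
  {ae (m \x @lebesgueI R)%E, forall z, -1 <= z.2 < 1 ->
    exists K : nat, forall k, (K <= k)%N -> `|Sum (k ^ 2) z| < e * (k ^ 2)%:R}.
Proof.
move=> e0; pose t k : R := e * (k.+1 ^ 2)%:R.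
have t0 k : 0 < t k by rewrite mulr_gt0// ltr0n expn_gt0.
have /choice[B HB] : forall k, exists B, [/\ measurable B,
    (forall w x, -1 <= x < 1 ->
       t k <= `|centered_sum p W f (k.+1 ^ 2) (letters a w x)| -> B (w, x)) &
    (P B <= (2 * a * expect p (k.+1 ^ 2 + W)
       (fun s => (t k <= `|centered_sum p W f (k.+1 ^ 2) s|)%R%:R))%:E)%E].
  move=> k; apply: window_cover => s s' ss'.
  by rewrite (depends_on_centered_sum p fW ss').
pose C : R := 2 * a * (2 * W + 1)%:R / e ^+ 2.
have C0 : 0 <= C by rewrite /C !mulr_ge0 ?invr_ge0 ?exprn_ge0// ltW.
have PB k : (P (B k) <= (C * (k.+1%:R ^+ 2)^-1)%:E)%E.
  have [_ _ /le_trans] := HB k; apply; rewrite lee_fin.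
  have -> : C * (k.+1%:R ^+ 2)^-1 =
      2 * a * ((2 * W + 1)%:R * (k.+1 ^ 2)%:R / t k ^+ 2).
    rewrite /C /t natrX; have : k.+1%:R != 0 :> R by rewrite pnatr_eq0.
    move: (k.+1%:R) ((2 * W + 1)%:R) => x y x0; field.
    by rewrite x0 gt_eqF.
  rewrite ler_pM2l ?mulr_gt0//; exact: chebyshev_centered_sum.
exists (lim_sup_set B); split.
- by apply: bigcapT_measurable => k; apply: bigcup_measurable => j _; have [] := HB j.
- apply: lim_sup_set_cvg0; first by move=> k; have [] := HB k.
  apply: (@le_lt_trans _ _ (C * 2)%:E); last exact: ltry.
  apply: lime_le; first by apply: is_cvg_nneseries => k _ _; exact: measure_ge0.
  apply: nearW => n; rewrite big_mkord.
  apply: (@le_trans _ _ (\sum_(k < n) (C * (k.+1%:R ^+ 2)^-1)%:E)%E).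
    by apply: lee_sum => k _; exact: PB.
  rewrite sumEFin lee_fin -mulr_sumr ler_wpM2l//.
  apply: le_trans (sum_inv_square_le n) _.
  by rewrite gerBl divr_ge0.
- move=> [w x] /= /not_implyP[x11] /forallNP H n _.
  (* [B k] concerns the time [k.+1 ^ 2], so the failure is sought from [n.+1] on, where the index is
     a successor. *)
  have := H n.+1; move=> /existsNP[k /not_implyP[nk /negP]]; rewrite -leNgt => tk.
  case: k nk tk => // k nk tk; exists k => //=.
  by have [_ + _] := HB k; exact.
Qed.

Lemma window_law :
  {ae (m \x @lebesgueI R)%E, forall z, Sum n z / n%:R @[n --> \oo] --> (0 : R)}.
Proof.
have /ae_foralln H (j : nat) :=
  ae_centered_sum_square (e := j.+1%:R^-1) (ltac:(by rewrite invr_gt0)).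
have FP : Filter (almost_everywhere (m \x @lebesgueI R)%E).
  exact: ae_filter_ringOfSetsType.
apply: filterS2 ae_symm_itv_open H => z z11 Hz.
apply: cvg_mean_of_squares => [n k|j]; last exact: Hz.
exact: norm_centered_sumB.
Qed.

End WindowLaw.

(** * Frequency of the digit 0 *)

Section Frequency.
Context {R : realType}.
Variables (p a : R).
Hypotheses (p01 : 0 <= p <= 1) (a1 : 1 <= a).

Definition window_freq M : R :=
  expect p (window_size M) (fun s => (zero_window a M s)%:R).

Definition bad_freq M : R :=
  expect p (window_size M) (fun s => (bad_window a M s)%:R).

(** For every [M] the frequency is asymptotically within [bad_freq M] of [window_freq M]; the
    supremum of the lower ends is a candidate limit that involves no point [(w, x)]. *)
Definition zero_limit : R := sup [set window_freq M - bad_freq M | M in setT].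

Let bad_freq_ge0 M : 0 <= bad_freq M.
Proof. by rewrite -[leLHS](expect_cst p (window_size M)) le_expect. Qed.

Let window_freq_ub : ubound [set window_freq M - bad_freq M | M in setT] (1 / 2).
Proof.
move=> _ [M _ <-]; have := expect_zero_window a p01 M.
by rewrite -/(window_freq M); have := bad_freq_ge0 M; lra.
Qed.

Lemma zero_limit_le : zero_limit <= 1 / 2.
Proof.
by apply: ge_sup => //; exists (window_freq 0 - bad_freq 0), 0%N.
Qed.

Lemma window_freq_le M : window_freq M - bad_freq M <= zero_limit.
Proof. by apply: ub_le_sup; [exists (1 / 2)|exists M]. Qed.

Lemma zero_freqE w x n :
  zero_freq a w x n = (\sum_(k < n) (digit a w x k == 0)%:R) / n%:R.
Proof.
rewrite /zero_freq; congr (_ / _).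
rewrite (eq_card (B := [pred k : 'I_n | digit a w x k == 0])); last first.
  by move=> k; rewrite !inE; apply/idP/idP => [/set_mem|H]; last exact/mem_set.
by rewrite -sum1_card natr_sum big_mkcond/=; apply: eq_bigr => k _; rewrite inE; case: ifP.
Qed.

Definition bit_indic (s : nat -> letter) : R := (s 0%N).1%:R.

Lemma depends_on_bit_indic : depends_on 1 bit_indic.
Proof. by move=> s s' ss'; rewrite /bit_indic ss'. Qed.

Lemma expect_bit_indic : expect p 1 bit_indic = 1 / 2.
Proof. by rewrite /= sum_letter /letter_weight /bit_indic /=; field. Qed.

Variables (w : coin_space) (x : R).
Hypothesis x11 : -1 <= x < 1.
Let L := letters a w x.

(** Once the coordinate reaches 0 it stays there and all later bits vanish, which contradicts a bit
    frequency of 1/2. *)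
Lemma double_orbit_gt0_of_bits :
  centered_sum p 1 bit_indic n L / n%:R @[n --> \oo] --> (0 : R) ->
  forall n, 0 < double_orbit a x n.
Proof.
move=> bits n; case/andP: (double_orbit_itv a1 x11 n) => v0 _.
rewrite lt_neqAle v0 andbT eq_sym; apply/negP => /eqP vn0.
have v0k k : double_orbit a x (n + k) = 0.
  elim: k => [|k IH]; first by rewrite addn0.
  rewrite addnS [LHS]/= -/(double_orbit a x (n + k)) IH /double_step.
  by rewrite leNgt divr_gt0//= mulr0 subr0.
have bk k : (n <= k)%N -> bit_indic (shift k L) = 0.
  move=> nk; rewrite /bit_indic /L /shift /= addn0 -(subnKC nk) v0k.
  by rewrite leNgt divr_gt0.
have cs N : centered_sum p 1 bit_indic N L <= n%:R - N%:R / 2.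
  rewrite /centered_sum expect_bit_indic sumrB sumr_const card_ord -[(1 / 2) *+ N]mulr_natl.
  rewrite [N%:R * (1 / 2)]mulrA mulr1 lerD2r.
  elim: N => [|N IH]; first by rewrite big_ord0.
  rewrite big_ord_recr/=; have [/bk ->|Nn] := leqP n N; first by rewrite addr0.
  apply: (@le_trans _ _ N.+1%:R); last by rewrite ler_nat.
  rewrite -natr1 lerD// /bit_indic; last by case: (_.1).
  rewrite -[leRHS]mulr1 mulr_natl -[X in _ *+ X]card_ord -sumr_const ler_sum// => i _.
  by case: (_.1).
have e4 : 0 < 1 / 4 :> R by lra.
have /cvgrPdist_lt/(_ _ e4) small := bits.
near \oo => N.
have : `|0 - centered_sum p 1 bit_indic N L / N%:R| < 1 / 4 by near: N.
(* At most [n] bits are 1, so beyond [4 * n] the centered average is below 1/4 - 1/2. *)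
have Nn : (4 * n < N)%N by near: N; exact: nbhs_infty_gt.
have N0 : 0 < N%:R :> R by rewrite ltr0n; apply: leq_ltn_trans Nn.
rewrite sub0r normrN ltr_norml => /andP[+ _].
rewrite ltr_pdivlMr//; have := cs N.
have : 4 * n%:R < N%:R :> R by rewrite -natrM ltr_nat.
lra.
Unshelve. all: by end_near. Qed.

Hypothesis vgt0 : forall n, 0 < double_orbit a x n.

(** The window at [k] predicts the digit at [k + M]; each bad window costs at most 1, and realigning
    the two sums costs at most [M]. *)
Lemma zero_sum_window M N :
  `|\sum_(k < N) (digit a w x k == 0)%:R
    - \sum_(k < N) (zero_window a M (shift k L))%:R| <=
  \sum_(k < N) (bad_window a M (shift k L))%:R + M%:R :> R.
Proof.
pose X k : R := (digit a w x k == 0)%:R.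
have X01 n m : 0 <= \sum_(k < m) X (n + k)%N <= m%:R.
  rewrite sumr_ge0//= -[leRHS]mulr1 mulr_natl -[X in _ *+ X]card_ord.
  by rewrite -sumr_const ler_sum// => i _; rewrite /X; case: eqP.
have H1 : `|\sum_(k < N) X (M + k)%N - \sum_(k < N) (zero_window a M (shift k L))%:R|
    <= \sum_(k < N) (bad_window a M (shift k L))%:R.
  rewrite -sumrB; apply: le_trans (ler_norm_sum _ _ _) _; apply: ler_sum => k _.
  have [_|good] := boolP (bad_window a M (shift k L)).
    by rewrite /X; case: eqP => _; case: zero_window;
      rewrite ?(subr0, sub0r, subrr, normrN, normr0, normr1).
  by rewrite /X addnC (digit_zero_window a1 x11 vgt0 good) subrr normr0.
have H2 : \sum_(k < N) X k + \sum_(k < M) X (N + k)%N =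
    \sum_(k < M) X k + \sum_(k < N) X (M + k)%N.
  transitivity (\sum_(k < N + M) X k); first by rewrite big_split_ord.
  by rewrite addnC big_split_ord.
have /andP[? ?] := X01 N M; have /andP[? ?] := X01 0%N M.
have H3 : `|\sum_(k < N) X k - \sum_(k < N) X (M + k)%N| <= M%:R.
  by rewrite ler_norml; apply/andP; split; lra.
rewrite [leRHS]addrC.
apply: le_trans (lerD H3 H1).
by rewrite (le_trans _ (ler_normD _ _))// addrA subrK.
Qed.

Lemma zero_freq_window M (e : R) : 0 < e ->
  centered_sum p (window_size M) (fun s => (zero_window a M s)%:R) n L / n%:R
    @[n --> \oo] --> (0 : R) ->
  centered_sum p (window_size M) (fun s => (bad_window a M s)%:R) n L / n%:R
    @[n --> \oo] --> (0 : R) ->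
  \forall n \near \oo, `|zero_freq a w x n - window_freq M| <= bad_freq M + e.
Proof.
move=> e0 zlaw blaw.
(* One third for each of the two centered averages, one third for [M / n]. *)
have e3 : 0 < e / 3 by rewrite divr_gt0.
have /cvgrPdist_lt/(_ _ e3) zsmall := zlaw.
have /cvgrPdist_lt/(_ _ e3) bsmall := blaw.
near=> n.
have : `|0 - centered_sum p (window_size M) (fun s => (zero_window a M s)%:R) n L / n%:R|
  < e / 3 by near: n.
have : `|0 - centered_sum p (window_size M) (fun s => (bad_window a M s)%:R) n L / n%:R|
  < e / 3 by near: n.
have n0 : 0 < n%:R :> R by rewrite ltr0n; near: n; exact: nbhs_infty_gt.
have Mn : M%:R <= e / 3 * n%:R.
  rewrite mulrC -ler_pdivrMr//; apply: ltW; apply: lt_le_trans (truncnS_gt _) _.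
  by rewrite ler_nat; near: n; exact: nbhs_infty_ge.
rewrite !sub0r !normrN !normrM !normfV !normr_nat !ltr_pdivrMr//.
rewrite /centered_sum -/(window_freq M) -/(bad_freq M) !sumrB !sumr_const card_ord.
rewrite -[bad_freq M *+ n]mulr_natl -[window_freq M *+ n]mulr_natl => hb hz.
have := zero_sum_window M n.
rewrite zero_freqE -[_ / _ - _](mulfK (lt0r_neq0 n0)) normrM normfV normr_nat.
rewrite ler_pdivrMr// mulrBl divfK ?lt0r_neq0//.
move: hb hz; rewrite !ltr_norml ![`|_| <= _]ler_norml.
move=> /andP[? ?] /andP[? ?] /andP[? ?]; apply/andP; split; lra.
Unshelve. all: by end_near. Qed.

Hypotheses
  (zlaw : forall M,
    centered_sum p (window_size M) (fun s => (zero_window a M s)%:R) n L / n%:R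
      @[n --> \oo] --> (0 : R))
  (blaw : forall M,
    centered_sum p (window_size M) (fun s => (bad_window a M s)%:R) n L / n%:R
      @[n --> \oo] --> (0 : R)).

(** At one large time the same frequency lies, up to [e / 2], in the intervals of both [M] and [M'],
    so the lower end for [M'] cannot exceed the upper end for [M]. *)
Let zero_limit_ge M : zero_limit <= window_freq M + bad_freq M.
Proof.
apply: ge_sup; first by exists (window_freq 0 - bad_freq 0), 0%N.
move=> _ [M' _ <-]; apply/ler_addgt0Pr => e e0.
have e2 : 0 < e / 2 by rewrite divr_gt0.
near \oo => n.
have : `|zero_freq a w x n - window_freq M| <= bad_freq M + e / 2.
  by near: n; exact: zero_freq_window.
have : `|zero_freq a w x n - window_freq M'| <= bad_freq M' + e / 2.
  by near: n; exact: zero_freq_window.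
by rewrite !ler_norml => /andP[? ?] /andP[? ?]; lra.
Unshelve. all: by end_near. Qed.

Lemma cvg_zero_freq : zero_freq a w x n @[n --> \oo] --> zero_limit.
Proof.
apply/cvgrPdist_lt => e e0.
have [M bM] : exists M, 2 * bad_freq M < e / 2.
  (* The constant 6 is twice the 3 of [expect_bad_window]. *)
  have : geometric (6 : R) 2^-1 n @[n --> \oo] --> (0 : R).
    by apply: cvg_geometric; rewrite ger0_norm ?invr_ge0// invf_lt1// ltr1n.
  have e2 : 0 < e / 2 by rewrite divr_gt0.
  move=> /cvgrPdist_lt/(_ _ e2)[M _ /(_ M (leqnn M))].
  rewrite /= sub0r normrN /geometric/= => hM; exists M.
  apply: le_lt_trans hM; rewrite (le_trans _ (ler_norm _))//.
  by have := expect_bad_window a p01 M; rewrite -/(bad_freq M); lra.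
have e2 : 0 < e / 4 by rewrite divr_gt0.
near=> n.
have : `|zero_freq a w x n - window_freq M| <= bad_freq M + e / 4.
  by near: n; exact: zero_freq_window.
have := zero_limit_ge M; have := window_freq_le M.
rewrite ler_norml ltr_norml => ? ? /andP[? ?]; apply/andP; split; lra.
Unshelve. all: by end_near. Qed.

End Frequency.

(** * Invariant densities *)

Section InvariantDensity.
Context {R : realType}.
Variables (p a : R) (m : probability coin_space R).
Hypotheses (a12 : 1 <= a <= 2) (mp : is_bernoulli_measure p m).

Lemma measurable_coord n : measurable_fun [set: coin_space] (fun w => w n).
Proof.
apply: (measurable_fun_bool true); rewrite setTI.
by apply: sub_sigma_algebra; exists n, true; apply/seteqP; split.
Qed.

Lemma measurable_coin_shift :
  measurable_fun [set: coin_space] (fun w => (fun n => w n.+1) : coin_space).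
Proof.
apply: (@measurability _ _ coin_space coin_space setT _ coordinate_sets) => //.
move=> _ [_ [n [b ->]] <-]; rewrite setTI.
by apply: sub_sigma_algebra; exists n.+1, b.
Qed.

Lemma measurable_random_doubling :
  measurable_fun [set: coin_space * measurableTypeR R] (random_doubling a).
Proof.
have m2 : measurable_fun [set: coin_space * measurableTypeR R] (fun z => z.2 : R).
  exact: measurable_snd.
apply: measurable_fun_pair.
  exact: (measurableT_comp measurable_coin_shift measurable_fst).
have md (k : R) : measurable_fun [set: coin_space * measurableTypeR R]
    (fun z => 2 * (z.2 : R) + k).
  by apply: measurable_funD => //; exact: measurable_funM.
apply: measurable_fun_ifT.
- exact: (measurableT_comp (measurable_coord 0) measurable_fst).
- apply: measurable_fun_ifT; [exact: measurable_fun_ltr|exact: md|].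
  apply: measurable_fun_ifT; [exact: measurable_fun_ltr| |exact: md].
  exact: measurable_funM.
- apply: measurable_fun_ifT; [exact: measurable_fun_ler|exact: md|].
  apply: measurable_fun_ifT; [exact: measurable_fun_ler| |exact: md].
  exact: measurable_funM.
Qed.

Lemma branch_digit_eq0 (b : bool) (x : R) : branch_digit a b x = 0 <->
  (if b then - (1 / 2) <= x < (a - 1) / 2 else (1 - a) / 2 < x <= 1 / 2).
Proof.
rewrite /branch_digit; case: b.
  by rewrite leNgt; case: (x < - _) => //=; case: (x < _).
by rewrite ltNge; case: (x <= (1 - a) / 2) => //=; case: (x <= _).
Qed.

Definition zero_digit_set (n : nat) : set (coin_space * measurableTypeR R) :=
  [set z | digit a z.1 z.2 n = 0].

Lemma zero_digit_set0 : zero_digit_set 0 =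
  ([set w : coin_space | w 0%N = false] `*` `](1 - a) / 2, 1 / 2]%classic) `|`
  ([set w : coin_space | w 0%N = true] `*` `[- (1 / 2), (a - 1) / 2[%classic).
Proof.
apply/seteqP; split => -[w x]; rewrite /zero_digit_set /digit /= !in_itv/=.
  by move=> /branch_digit_eq0; case: (w 0%N); [right|left].
by move=> [] [w0 xw]; apply/branch_digit_eq0; rewrite w0.
Qed.

Lemma zero_digit_setS n :
  zero_digit_set n.+1 = random_doubling a @^-1` zero_digit_set n.
Proof.
apply/seteqP; split => -[w x]; rewrite /zero_digit_set /digit /=;
  suff -> : T a (w n) (Defs.orbit a w x n) =
    Defs.orbit a (fun k => w k.+1) (T a (w 0%N) x) n by [].
all: by elim: n => //= n ->.
Qed.

Lemma measurable_coin b : measurable [set w : coin_space | w 0%N = b].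
Proof. by apply: sub_sigma_algebra; exists 0%N, b. Qed.

Lemma measurable_zero_digit_set n : measurable (zero_digit_set n).
Proof.
elim: n => [|n IH].
  rewrite zero_digit_set0; apply: measurableU; apply: measurableX;
    by [exact: measurable_coin|exact: measurable_itv].
rewrite zero_digit_setS -[X in measurable X]setTI.
exact: measurable_random_doubling.
Qed.

Lemma bernoulli_coin b : m [set w | w 0%N = b] = (if b then 1 - p else p)%:E.
Proof.
have := mp [:: b]; rewrite big_seq1 => <-; congr (m _).
by apply/seteqP; split => [w wb [|]//|w /(_ 0%N)]; exact.
Qed.

Variable mu : probability (measurableTypeR R) R.
Hypothesis mu_acim : is_acim a m mu.

Let mu_set1 (x : R) : mu [set x] = 0%E.
Proof.
have [dom _] := mu_acim; apply: (dom [set x]) => //.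
apply/measure0_null_setP => //; apply/eqP; rewrite -measure_le0.
rewrite -(lebesgue_measure_set1 x) /lebesgueI /= /mfrestr /mrestr le_measure ?inE//.
by apply: measurableI => //; exact: measurable_symm_itv.
Qed.

Let c : R := (a - 1) / 2.

Let c_itv : 0 <= c <= 1 / 2.
Proof. by have := a12; rewrite /c; lra. Qed.

Let I2 : set (measurableTypeR R) := `[- (1 / 2), - c]%classic.
Let I3 : set (measurableTypeR R) := `]- c, c[%classic.
Let I4 : set (measurableTypeR R) := `[c, 1 / 2]%classic.

Let mI2 : measurable I2. Proof. exact: measurable_itv. Qed.
Let mI3 : measurable I3. Proof. exact: measurable_itv. Qed.
Let mI4 : measurable I4. Proof. exact: measurable_itv. Qed.

(* For [a = 1] the set [I3] is empty and [I2], [I4] share the endpoint 0. *)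
Let mu_split_right : mu `]- c, 1 / 2]%classic = (mu I3 + mu I4)%E.
Proof.
have /andP[c0 c1] := c_itv; rewrite -measureU//; last first.
  by apply/seteqP; split => x //= []; rewrite /I3 /I4 /= !in_itv/=; lra.
move: c0; rewrite le_eqVlt => /predU1P[c0|c0].
  rewrite /I3 /I4 -c0 oppr0 set_itvoo0 set0U -(@setU1itv _ _ _ _ false) ?bnd_simp ?divr_ge0//.
  rewrite measureU//.
    by rewrite [X in (X + _)%E](_ : _ = 0%E) ?add0e//; exact: mu_set1.
  by apply/seteqP; split => x //= [->]; rewrite in_itv/= ltxx.
by rewrite /I3 /I4 -itv_bndbnd_setU// bnd_simp; lra.
Qed.

Let mu_split_left : mu `[- (1 / 2), c[%classic = (mu I2 + mu I3)%E.
Proof.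
have /andP[c0 c1] := c_itv; rewrite -measureU//; last first.
  by apply/seteqP; split => x //= []; rewrite /I2 /I3 /= !in_itv/=; lra.
move: c0; rewrite le_eqVlt => /predU1P[c0|c0].
  rewrite /I2 /I3 -c0 oppr0 set_itvoo0 setU0 -(@setUitv1 _ _ _ _ true)
    ?bnd_simp ?oppr_le0 ?divr_ge0//.
  rewrite measureU//.
    by rewrite [X in (_ + X)%E](_ : _ = 0%E) ?adde0//; exact: mu_set1.
  by apply/seteqP; split => x //= [+ xE]; rewrite xE in_itv/= ltxx andbF.
by rewrite /I2 /I3 -itv_bndbnd_setU// bnd_simp; lra.
Qed.

(** Invariance reduces to [n = 0]. There the coin [false], of weight [p], gives the digit 0 on [I3]
    and [I4], and the coin [true] gives it on [I2] and [I3]. *)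
Lemma acim_zero_digit n : (m \x mu)%E (zero_digit_set n) = (pi0_of a p mu)%:E.
Proof.
have [_ inv] := mu_acim.
elim: n => [|n <-]; last by rewrite zero_digit_setS inv//; exact: measurable_zero_digit_set.
have mc b := measurable_coin b.
rewrite zero_digit_set0 measureU//; last 3 first.
- by apply: measurableX => //; exact: measurable_itv.
- by apply: measurableX => //; exact: measurable_itv.
- by apply/seteqP; split => -[w x] //= [[-> _] []].
rewrite [X in (X + _)%E]product_measure1E//.
rewrite [X in (_ + X)%E]product_measure1E//.
rewrite [X in (X * _ + _)%E](_ : _ = p%:E); last exact: (bernoulli_coin false).
rewrite [X in (_ + X * _)%E](_ : _ = (1 - p)%:E); last exact: (bernoulli_coin true).
have cE : (1 - a) / 2 = - c by rewrite /c; field.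
rewrite /pi0_of cE -/c.
rewrite [X in (p%:E * X + _)%E](_ : _ = (mu I3 + mu I4)%E);
  last exact: mu_split_right.
rewrite [X in (_ + (1 - p)%:E * X)%E](_ : _ = (mu I2 + mu I3)%E);
  last exact: mu_split_left.
have fE (A : set (measurableTypeR R)) : measurable A -> mu A = (fine (mu A))%:E.
  by move=> mA; rewrite fineK// fin_num_measure.
rewrite (fE I2)// (fE I3)// (fE I4)//.
by rewrite -!EFinD /=; congr EFin; ring.
Qed.

(** Absolute continuity passes to the product by sections: almost every section of a null cover is
    Lebesgue-null, hence [mu]-null. *)
Lemma acim_negligible (N : set (coin_space * measurableTypeR R)) :
  (m \x @lebesgueI R)%E.-negligible N -> (m \x mu)%E.-negligible N.
Proof.
move=> [A [mA A0 NA]]; exists A; split=> //.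
have [dom _] := mu_acim.
have mf : measurable_fun [set: coin_space] ((@lebesgueI R) \o xsection A).
  exact: measurable_fun_xsection.
have /(ae_eq_integral_abs m measurableT mf) lebA0 :
    (\int[m]_w `|((@lebesgueI R) \o xsection A) w| = 0)%E.
  by rewrite -[RHS]A0; apply: eq_integral => w _; rewrite gee0_abs ?measure_ge0.
have <- : (\int[m]_w (cst 0 w) = 0)%E by rewrite integral0.
apply: ae_eq_integral => //; first exact: measurable_fun_xsection.
apply: filterS lebA0 => w /(_ Logic.I) /= lw _.
apply: (dom (xsection A w)) => //; last exact: measurable_xsection.
by apply/measure0_null_setP => //; exact: measurable_xsection.
Qed.

Lemma acim_zero_limit (l : R) :
  {ae (m \x @lebesgueI R)%E, forall z, zero_freq a z.1 z.2 n @[n --> \oo] --> l} ->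
  l = pi0_of a p mu.
Proof.
move=> /acim_negligible freq.
pose F n (z : coin_space * measurableTypeR R) : R :=
  (\sum_(k < n) \1_(zero_digit_set k) z) / n%:R.
have FE n z : F n z = zero_freq a z.1 z.2 n.
  rewrite zero_freqE /F; congr (_ / _); apply: eq_bigr => k _; rewrite indicE.
  congr (nat_of_bool _)%:R; apply/idP/idP => [/set_mem/= ->//|/eqP k0].
  exact/mem_set.
pose G n (z : coin_space * measurableTypeR R) : R :=
  \sum_(k < n) \1_(zero_digit_set k) z.
have mG n : measurable_fun setT (G n).
  apply: measurable_sum => k.
  exact: measurable_indic (measurable_zero_digit_set k).
have G0 n z : 0 <= G n z by apply: sumr_ge0.
have mF n : measurable_fun setT (F n) by apply: measurable_funM => //; exact: mG.
have F01 n z : 0 <= F n z <= 1.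
  rewrite /F divr_ge0 ?sumr_ge0//=.
  case: n => [|n]; first by rewrite invr0 mulr0.
  rewrite ler_pdivrMr// mul1r -[leRHS]mulr1 mulr_natl -[X in _ *+ X]card_ord.
  by rewrite -sumr_const ler_sum// => k _; rewrite indicE; case: (_ \in _).
have intG n : (\int[(m \x mu)%E]_z (G n z)%:E = (n%:R * pi0_of a p mu)%:E)%E.
  elim: n => [|n IH].
    rewrite mul0r -[RHS](integral0 (m \x mu)%E setT).
    by apply: eq_integral => z _; rewrite /G big_ord0.
  transitivity (\int[(m \x mu)%E]_z ((G n z)%:E + (\1_(zero_digit_set n) z)%:E))%E.
    by apply: eq_integral => z _; rewrite /G big_ord_recr EFinD.
  have mD := measurable_zero_digit_set n.
  rewrite ge0_integralD//; last 3 first.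
  - by move=> z _; rewrite lee_fin.
  - by apply/measurable_EFinP; exact: mG.
  - by apply/measurable_EFinP; exact: measurable_indic.
  rewrite integral_indic// setIT IH [X in (_ + X)%E]acim_zero_digit -EFinD.
  by rewrite -natr1 mulrDl mul1r.
(* The index starts at 1 because [F 0] is 0 by the convention on division by 0. *)
have intF n : (\int[(m \x mu)%E]_z (F n.+1 z)%:E = (pi0_of a p mu)%:E)%E.
  transitivity (\int[(m \x mu)%E]_z ((n.+1%:R^-1)%:E * (G n.+1 z)%:E))%E.
    by apply: eq_integral => z _; rewrite /F mulrC EFinM.
  rewrite ge0_integralZl//; last 2 first.
  - by apply/measurable_EFinP; exact: mG.
  - by move=> z _; rewrite lee_fin.
  by rewrite intG -EFinM mulKf.
have QT : (m \x mu)%E setT = 1%E.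
  rewrite -setXTT product_measure1E//.
  by rewrite [X in (X * _)%E]probability_setT mul1e; exact: probability_setT.
have [] := @dominated_convergence _ _ _ (m \x mu)%E setT measurableT
  (fun n z => (F n.+1 z)%:E) (cst l%:E) (cst 1%E).
- by move=> n; apply/measurable_EFinP; exact: mF.
- exact: measurable_cst.
- apply: negligibleS freq => z /= Hz freqz; apply: Hz => _.
  apply/cvg_EFin; first exact: nearW.
  rewrite (_ : _ \o _ = fun n => zero_freq a z.1 z.2 n.+1); last first.
    by apply/funext => n /=; rewrite FE.
  by rewrite -cvg_shiftS in freqz.
- apply/integrableP; split; first exact: measurable_cst.
  rewrite (eq_integral (cst 1%E)); last by move=> z _; rewrite /= normr1.
  by rewrite integral_cst// mul1e [X in (X < _)%E]QT ltry.
- by apply: aeW => z n _ /=; rewrite lee_fin ger0_norm; case/andP: (F01 n.+1 z).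
move=> _ _; rewrite integral_cst// [X in (_ * X)%E]QT mule1.
under eq_fun do rewrite intF.
by move=> /(cvg_lim (@ereal_hausdorff _)); rewrite lim_cst// => -[].
Qed.

End InvariantDensity.

Unset Implicit Arguments.

Theorem theorem3p12 (R : realType) (p alpha : R)
    (hp : 0 < p < 1) (halpha : 1 <= alpha <= 2)
    (m : probability coin_space R) (hm : is_bernoulli_measure p m) :
  exists pi0 : R,
    [/\ forall mu : probability (measurableTypeR R) R,
          is_acim alpha m mu -> pi0 = pi0_of alpha p mu,
        {ae (m \x lebesgueI)%E, forall z,
          zero_freq alpha z.1 z.2 n @[n --> \oo] --> pi0}
      & pi0 <= 1 / 2].
Proof.
have p01 : 0 <= p <= 1 by case/andP: hp => /ltW -> /ltW ->.
have a1 : 1 <= alpha by case/andP: halpha.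
have freq : {ae (m \x lebesgueI)%E, forall z,
    zero_freq alpha z.1 z.2 n @[n --> \oo] --> zero_limit p alpha}.
  have FP : Filter (almost_everywhere (m \x @lebesgueI R)%E).
    exact: ae_filter_ringOfSetsType.
  have b01 (b : bool) : 0 <= (b%:R : R) <= 1 by rewrite ler0n lern1 leq_b1.
  (* The law for single bits serves only to keep the doubling coordinate away from 0. *)
  have bits := window_law p01 a1 hm depends_on_bit_indic (fun s => b01 _).
  have zeros : {ae (m \x @lebesgueI R)%E, forall z M, centered_sum p (window_size M)
      (fun s => (zero_window alpha M s)%:R) n (letters alpha z.1 z.2) / n%:R
      @[n --> \oo] --> (0 : R)}.
    apply/ae_foralln => M; apply: window_law => // s s' ss'.
    by rewrite (depends_on_zero_window alpha ss').
  have bads : {ae (m \x @lebesgueI R)%E, forall z M, centered_sum p (window_size M)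
      (fun s => (bad_window alpha M s)%:R) n (letters alpha z.1 z.2) / n%:R
      @[n --> \oo] --> (0 : R)}.
    apply/ae_foralln => M; apply: window_law => // s s' ss'.
    by rewrite (depends_on_bad_window alpha ss').
  apply: filterS2 (filterI (ae_symm_itv_open m) bits) (filterI zeros bads).
  move=> z [z11 zbits] [zzeros zbads].
  apply: cvg_zero_freq => //; exact: double_orbit_gt0_of_bits zbits.
(* The witness is defined without reference to [mu], so one value serves every invariant measure. *)
exists (zero_limit p alpha); split=> //; last exact: zero_limit_le.
by move=> mu acim; exact: acim_zero_limit freq.
Qed.
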